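(* Let $H=(H,\Delta,\varepsilon,\Phi,\alpha,\beta,S)$ be a finite-dimensional semi-simple quasi-Hopf algebra over a field $k$ and let $\Lambda$ be the normalized two-sided integral of $H$. Then $\nu_H$ is invariant under gauge transformations, that is, $$\nu_H=\nu_{H_F}$$ for any gauge transformation $F$ on $H$. Moreover, $$\beta\alpha\,\nu_H=\nu_H\,\beta\alpha=\sum\Lambda_1\Lambda_2,$$ where $\sum\Lambda_1\otimes\Lambda_2=\Delta(\Lambda)$. In particular, if both $\alpha$ and $\beta$ are units of $H$, then $$\nu_H=\Big(\sum\Lambda_1\Lambda_2\Big)(\beta\alpha)^{-1}=(\beta\alpha)^{-1}\sum\Lambda_1\Lambda_2 .$$
   Context: A quasi-bialgebra over a field $k$ is $(H,\Delta,\varepsilon,\Phi)$ with $H$ a unital associative $k$-algebra, $\Delta:H\to H\otimes H$ and $\varepsilon:H\to k$ algebra maps, and $\Phi\in H\otimes H\otimes H$ invertible such that $(\varepsilon\otimes id)\Delta=id=(id\otimes\varepsilon)\Delta$; $\Phi(\Delta\otimes id)\Delta(h)\Phi^{-1}=(id\otimes\Delta)\Delta(h)$ for all $h$; $(id\otimes id\otimes\Delta)(\Phi)(\Delta\otimes id\otimes id)(\Phi)=(1\otimes\Phi)(id\otimes\Delta\otimes id)(\Phi)(\Phi\otimes1)$; $(id\otimes\varepsilon\otimes id)(\Phi)=1\otimes1$. Write $\Delta(h)=\sum h_1\otimes h_2$, $\Phi=\sum X_i\otimes Y_i\otimes Z_i$, $\Phi^{-1}=\sum\overline X_i\otimes\overline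 Y_i\otimes\overline Z_i$. A quasi-Hopf algebra $(H,\Delta,\varepsilon,\Phi,\alpha,\beta,S)$ is a quasi-bialgebra with an algebra anti-automorphism $S$ (the antipode) and $\alpha,\beta\in H$ such that for all $h\in H$: $\sum S(h_1)\alpha h_2=\varepsilon(h)\alpha$, $\sum h_1\beta S(h_2)=\varepsilon(h)\beta$, $\sum X_i\beta S(Y_i)\alpha Z_i=1$, $\sum S(\overline X_i)\alpha\overline Y_i\beta S(\overline Z_i)=1$. Define $q_L=\sum S(\overline X_i)\alpha\overline Y_i\otimes\overline Z_i$ and $p_L=\sum Y_iS^{-1}(X_i\beta)\otimes Z_i$ in $H\otimes H$. A gauge transformation on $H$ is an invertible $F=\sum f_i\otimes g_i\in H\otimes H$ with $(\varepsilon\otimes id)(F)=1=(id\otimes\varepsilon)(F)$. Write $F^{-1}=\sum d_i\otimes e_i$. Then $H_F=(H,\Delta_F,\varepsilon,\Phi_F,\alpha_F,\beta_F,S)$ is a quasi-Hopf algebra, where $\Delta_F(h)=F\Delta(h)F^{-1}$, $\Phi_F=(1\otimes F)(id\otimes\Delta)(F)\,\Phi\,(\Delta\otimes id)(F^{-1})(F^{-1}\otimes1)$, $\alpha_F=\sum S(d_i)\alpha e_i$, $\beta_F=\sum f_i\beta S(g_i)$. A two-sided integral of $H$ is $l\in H$ with $hl=\varepsilon(h)l=lh$ for all $h\in H$; it is normalized if $\varepsilon(l)=1$. A finite-dimensional semi-simple quasi-Hopf algebra has a unique normalized two-sided integral $\Lambda$ (known fact). Define $\nu_H=m(q_L\Delta(\Lambda)p_L)\in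 H$, where $m$ is the multiplication of $H$. *)

(* Defs.v *)
From HB Require Import structures.
From mathcomp Require Import all_boot all_algebra all_field.

Set Implicit Arguments.
Unset Strict Implicit.
Unset Printing Implicit Defensive.

Import GRing.Theory.
Local Open Scope ring_scope.

(* The tensor product of two finite-dimensional algebras. An element is the    *)
(* matrix of its coordinates on the e_i ⊗ f_j, where e and f are the bases     *)
(* chosen by vbasis. Nothing below depends on that choice: tlift_pure is the   *)
(* universal property, and tensor_ind says that the pure tensors span.         *)
Definition tensor (k : fieldType) (A B : falgType k) : Type :=
  'M[k]_(\dim {:A}, \dim {:B}).

HB.instance Definition _ (k : fieldType) (A B : falgType k) :=
  Vector.copy (tensor A B) 'M[k]_(\dim {:A}, \dim {:B}).

Definition pure (k : fieldType) (A B : falgType k) (a : A) (b : B) :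
    tensor A B :=
  \matrix_(i, j) (coord (vbasis {:A}) i a * coord (vbasis {:B}) j b).

Notation "a ⊗ b" := (pure a b) (at level 40, left associativity) : ring_scope.

(* For f bilinear, tlift f sends \sum a_i ⊗ b_i to \sum f a_i b_i.             *)
Definition tlift (k : fieldType) (A B : falgType k) (V : lmodType k)
    (f : A -> B -> V) (t : tensor A B) : V :=
  \sum_i \sum_j (t : 'M_(_, _)) i j *: f (vbasis {:A})`_i (vbasis {:B})`_j.

Section TensorSpace.
Variables (k : fieldType) (A B : falgType k).
Implicit Types (V : lmodType k) (t : tensor A B).

Lemma pureDl (a a' : A) (b : B) : (a + a') ⊗ b = a ⊗ b + a' ⊗ b.
Proof. by apply/matrixP=> i j; rewrite !mxE linearD mulrDl. Qed.

Lemma pureDr (a : A) (b b' : B) : a ⊗ (b + b') = a ⊗ b + a ⊗ b'.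
Proof. by apply/matrixP=> i j; rewrite !mxE linearD mulrDr. Qed.

Lemma pureZl c (a : A) (b : B) : (c *: a) ⊗ b = c *: (a ⊗ b).
Proof. by apply/matrixP=> i j; rewrite !mxE linearZ mulrA. Qed.

Lemma pureZr c (a : A) (b : B) : a ⊗ (c *: b) = c *: (a ⊗ b).
Proof. by apply/matrixP=> i j; rewrite !mxE linearZ /= mulrCA. Qed.

Lemma tlift_is_linear V (f : A -> B -> V) : linear (tlift f).
Proof.
move=> c s t; rewrite /tlift scaler_sumr -big_split; apply: eq_bigr => i _ /=.
rewrite scaler_sumr -big_split; apply: eq_bigr => j _ /=.
by rewrite !mxE scalerDl scalerA.
Qed.

HB.instance Definition _ V (f : A -> B -> V) :=
  GRing.isLinear.Build k (tensor A B) V _ (tlift f) (tlift_is_linear f).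

Lemma tlift_pure V (f : A -> B -> V) (a : A) (b : B) :
    (forall y, linear (f^~ y)) -> (forall x, linear (f x)) ->
  tlift f (a ⊗ b) = f a b.
Proof.
move=> fl fr.
pose fL y := GRing.isLinear.Build k A V _ (f^~ y) (fl y).
pose fR x := GRing.isLinear.Build k B V _ (f x) (fr x).
pose FL y : {linear A -> V} := HB.pack (f^~ y) (fL y).
pose FR x : {linear B -> V} := HB.pack (f x) (fR x).
rewrite {2}(coord_vbasis (memvf a)) -[f _ b]/(FL b _) linear_sum.
apply: eq_bigr => i _; rewrite linearZ /= {2}(coord_vbasis (memvf b)).
rewrite -[f _ (\sum_j _)]/(FR _ _) linear_sum scaler_sumr.
by apply: eq_bigr => j _; rewrite linearZ /= scalerA mxE.
Qed.

Lemma tensor_ind (P : tensor A B -> Prop) :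
    (forall c s t, P s -> P t -> P (c *: s + t)) ->
    (forall a b, P (a ⊗ b)) ->
  forall t, P t.
Proof.
move=> Plin Ppure t.
have P0: P 0 by have := Ppure 0 0; rewrite -(scale0r (0 : A)) pureZl scale0r.
have PD s s' : P s -> P s' -> P (s + s').
  by move=> Ps Ps'; rewrite -[s]scale1r; apply: Plin.
have PZ c s : P s -> P (c *: s) by move=> Ps; rewrite -[_ *: _]addr0; apply: Plin.
suff ->: t = tlift (@pure k A B) t.
  by apply: big_ind => // i _; apply: big_ind => // j _; apply: PZ.
rewrite [LHS]matrix_sum_delta; apply: eq_bigr => i _; apply: eq_bigr => j _.
congr (_ *: _); apply/matrixP=> x y; rewrite !mxE.
rewrite !coord_free ?(basis_free (vbasisP _)) // -natrM mulnb.
by rewrite [x == i]eq_sym [y == j]eq_sym.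
Qed.

Lemma tensor_eq_lin V (f g : tensor A B -> V) :
    linear f -> linear g -> (forall a b, f (a ⊗ b) = g (a ⊗ b)) -> f =1 g.
Proof.
move=> fl gl fg; elim/tensor_ind => // c s t fgs fgt.
by rewrite fl gl fgs fgt.
Qed.

End TensorSpace.

(* (a ⊗ b) (a' ⊗ b') = a a' ⊗ b b'; see tmulM.                                 *)
Definition tmul (k : fieldType) (A B : falgType k) (s t : tensor A B) :
    tensor A B :=
  tlift (fun a b => tlift (fun a' b' => (a * a') ⊗ (b * b')) t) s.

Section TensorAlgebra.
Variables (k : fieldType) (A B : falgType k).
Implicit Types (s t u : tensor A B).

Lemma tmul_purel (a : A) (b : B) t :
  tmul (a ⊗ b) t = tlift (fun a' b' => (a * a') ⊗ (b * b')) t.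
Proof.
rewrite /tmul tlift_pure // => [y | x] c z z'.
- move: t; apply: tensor_eq_lin => [||a' b'].
  + exact: tlift_is_linear.
  + by move=> d v w /=; rewrite !tlift_is_linear !scalerDr !scalerA ![d * c]mulrC addrACA.
  + rewrite !tlift_pure ?mulrDl ?pureDl -?scalerAl ?pureZl //;
      by move=> ? ? ? ?; rewrite mulrDr (pureDl, pureDr) -scalerAr (pureZl, pureZr).
- move: t; apply: tensor_eq_lin => [||a' b'].
  + exact: tlift_is_linear.
  + by move=> d v w /=; rewrite !tlift_is_linear !scalerDr !scalerA ![d * c]mulrC addrACA.
  + rewrite !tlift_pure ?mulrDl ?pureDr -?scalerAl ?pureZr //;
      by move=> ? ? ? ?; rewrite mulrDr (pureDl, pureDr) -scalerAr (pureZl, pureZr).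
Qed.

Lemma tmulM (a a' : A) (b b' : B) :
  tmul (a ⊗ b) (a' ⊗ b') = (a * a') ⊗ (b * b').
Proof.
rewrite tmul_purel tlift_pure // => ? ? ? ?;
by rewrite mulrDr (pureDl, pureDr) -scalerAr (pureZl, pureZr).
Qed.

Lemma tmul_linl t : linear ((@tmul k A B)^~ t). Proof. exact: tlift_is_linear. Qed.

Lemma tmul_linr s : linear (tmul s).
Proof.
move=> c t u; move: s; apply: tensor_eq_lin => [||a b].
- exact: tmul_linl.
- move=> d v w; rewrite !tmul_linl !scalerDr !scalerA [d * c]mulrC.
  by rewrite addrACA.
- by rewrite !tmul_purel linearP.
Qed.

Lemma tmulA : associative (@tmul k A B).
Proof.
move=> s t u.
elim/tensor_ind: s => [c s s' IHs IHs'|a b]; first by rewrite !tmul_linl IHs IHs'.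
elim/tensor_ind: t => [c t t' IHt IHt'|a' b'].
  by rewrite tmul_linl !tmul_linr tmul_linl IHt IHt'.
elim/tensor_ind: u => [c u u' IHu IHu'|a'' b'']; first by rewrite !tmul_linr IHu IHu'.
by rewrite !tmulM !mulrA.
Qed.

Lemma tmul1t : left_id (1 ⊗ 1) (@tmul k A B).
Proof.
elim/tensor_ind => [c t t' IHt IHt'|a b]; first by rewrite tmul_linr IHt IHt'.
by rewrite tmulM !mul1r.
Qed.

Lemma tmult1 : right_id (1 ⊗ 1) (@tmul k A B).
Proof.
elim/tensor_ind => [c t t' IHt IHt'|a b]; first by rewrite tmul_linl IHt IHt'.
by rewrite tmulM !mulr1.
Qed.

Lemma tmulDl : left_distributive (@tmul k A B) +%R.
Proof. by move=> s t u; rewrite -[s]scale1r tmul_linl !scale1r. Qed.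

Lemma tmulDr : right_distributive (@tmul k A B) +%R.
Proof. by move=> s t u; rewrite -[t]scale1r tmul_linr !scale1r. Qed.

Lemma pure11_neq0 : (1 : A) ⊗ (1 : B) != 0.
Proof.
have [i Ai]: exists i, coord (vbasis {:A}) i 1 != 0.
  apply/existsP; apply: contraNT (oner_neq0 A); rewrite negb_exists => /forallP A0.
  rewrite (coord_vbasis (memvf (1 : A))) big1 // => i _.
  by move/negPn/eqP: (A0 i) => ->; rewrite scale0r.
have [j Bj]: exists j, coord (vbasis {:B}) j 1 != 0.
  apply/existsP; apply: contraNT (oner_neq0 B); rewrite negb_exists => /forallP B0.
  rewrite (coord_vbasis (memvf (1 : B))) big1 // => j _.
  by move/negPn/eqP: (B0 j) => ->; rewrite scale0r.
apply/eqP=> /matrixP/(_ i j); rewrite !mxE => /eqP.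
by rewrite mulf_eq0 (negPf Ai) (negPf Bj).
Qed.

HB.instance Definition _ := GRing.Zmodule_isNzRing.Build (tensor A B)
  tmulA tmul1t tmult1 tmulDl tmulDr pure11_neq0.

Lemma tmulZl c s t : c *: (s * t) = (c *: s) * t.
Proof.
have := tmul_linl t c s 0; rewrite /= addr0 -[tmul 0 t]/(0 * t) mul0r addr0.
exact: esym.
Qed.

Lemma tmulZr c s t : c *: (s * t) = s * (c *: t).
Proof.
have := tmul_linr s c t 0; rewrite /= addr0 -[tmul s 0]/(s * 0) mulr0 addr0.
exact: esym.
Qed.

HB.instance Definition _ := GRing.Lmodule_isLalgebra.Build k (tensor A B) tmulZl.
HB.instance Definition _ := GRing.Lalgebra_isAlgebra.Build k (tensor A B) tmulZr.
HB.instance Definition _ := Algebra_isFalgebra.Build k (tensor A B).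

Lemma pureM (a a' : A) (b b' : B) : (a ⊗ b) * (a' ⊗ b') = (a * a') ⊗ (b * b').
Proof. exact: tmulM. Qed.

Lemma pure11 : 1 = 1 ⊗ 1 :> tensor A B. Proof. by []. Qed.

End TensorAlgebra.

Definition tmap (k : fieldType) (A B A' B' : falgType k)
    (f : A -> A') (g : B -> B') (t : tensor A B) : tensor A' B' :=
  tlift (fun a b => f a ⊗ g b) t.

Definition tassoc (k : fieldType) (A B C : falgType k)
    (t : tensor A (tensor B C)) : tensor (tensor A B) C :=
  tlift (fun a u => tlift (fun b c => a ⊗ b ⊗ c) u) t.

Definition tlift3 (k : fieldType) (A B C : falgType k) (V : lmodType k)
    (f : A -> B -> C -> V) (t : tensor (tensor A B) C) : V :=
  tlift (fun u c => tlift (fun a b => f a b c) u) t.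

Lemma tmap_pure (k : fieldType) (A B A' B' : falgType k)
    (f : A -> A') (g : B -> B') (a : A) (b : B) :
  linear f -> linear g -> tmap f g (a ⊗ b) = f a ⊗ g b.
Proof.
move=> fl gl; rewrite /tmap tlift_pure // => y c u v;
by rewrite (fl, gl) (pureDl, pureDr) (pureZl, pureZr).
Qed.

Lemma tassoc_pure (k : fieldType) (A B C : falgType k) (a : A) (b : B) (c : C) :
  tassoc (a ⊗ (b ⊗ c)) = a ⊗ b ⊗ c.
Proof.
have bl x : forall y, linear (fun b : B => (x : A) ⊗ b ⊗ (y : C)).
  by move=> y d u v; rewrite pureDr pureZr pureDl pureZl.
have cl (x : tensor A B) : linear (fun c : C => x ⊗ c).
  by move=> d u v; rewrite pureDr pureZr.
rewrite /tassoc tlift_pure ?tlift_pure // => [y|x]; last exact: tlift_is_linear.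
move=> d u v; move: y; apply: tensor_eq_lin => [||b' c'].
- exact: tlift_is_linear.
- move=> e s t /=; rewrite !tlift_is_linear !scalerDr !scalerA [e * d]mulrC.
  by rewrite addrACA.
- by rewrite !tlift_pure // pureDl pureZl pureDl pureZl.
Qed.

Lemma tlift3_pure (k : fieldType) (A B C : falgType k) (V : lmodType k)
    (f : A -> B -> C -> V) (a : A) (b : B) (c : C) :
    (forall y z, linear (fun x => f x y z)) ->
    (forall x z, linear (fun y => f x y z)) ->
    (forall x y, linear (fun z => f x y z)) ->
  tlift3 f (a ⊗ b ⊗ c) = f a b c.
Proof.
move=> fa fb fc; rewrite /tlift3 tlift_pure ?tlift_pure // => [y|x].
  exact: tlift_is_linear.
move=> d u v; move: x; apply: tensor_eq_lin => [||a' b'].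
- exact: tlift_is_linear.
- move=> e s t /=; rewrite !tlift_is_linear !scalerDr !scalerA [e * d]mulrC.
  by rewrite addrACA.
- by rewrite !tlift_pure // fc.
Qed.

(* The data (Δ, ε, Φ, α, β, S) on an algebra H; is_quasi_hopf states the axioms. *)
Record quasi_hopf_data (k : fieldType) (H : falgType k) := QuasiHopfData {
  comul : H -> tensor H H;
  counit : H -> k;
  associator : tensor (tensor H H) H;
  qalpha : H;
  qbeta : H;
  antipode : 'End(H)
}.

Section QuasiHopf.
Variables (k : fieldType) (H : falgType k).
Implicit Types (D : quasi_hopf_data H) (F : tensor H H) (h l : H).

Definition counit_id D (t : tensor H H) : H :=
  tlift (fun a b => counit D a *: b) t.
Definition id_counit D (t : tensor H H) : H :=
  tlift (fun a b => counit D b *: a) t.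

(* Iterated tensor products are bracketed to the left, so id ⊗ Δ and 1 ⊗ _     *)
(* have to be composed with associativity isomorphisms.                        *)
Definition comul_id D (t : tensor H H) : tensor (tensor H H) H :=
  tmap (comul D) id t.
Definition id_comul D (t : tensor H H) : tensor (tensor H H) H :=
  tassoc (tmap id (comul D) t).

Definition comul_id_id D (t : tensor (tensor H H) H) :
    tensor (tensor (tensor H H) H) H :=
  tmap (comul_id D) id t.
Definition id_comul_id D (t : tensor (tensor H H) H) :
    tensor (tensor (tensor H H) H) H :=
  tmap (id_comul D) id t.
Definition id_id_comul D (t : tensor (tensor H H) H) :
    tensor (tensor (tensor H H) H) H :=
  tassoc (tmap id (comul D) t).

Definition one_tensor2 (t : tensor H H) : tensor (tensor H H) H :=
  tassoc (1 ⊗ t).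
Definition one_tensor3 (t : tensor (tensor H H) H) :
    tensor (tensor (tensor H H) H) H :=
  tmap (@tassoc k H H H) id (tassoc (1 ⊗ t)).

Definition is_quasi_bialgebra D : Prop :=
  let Delta := comul D in
  let eps := counit D in
  let Phi := associator D in
  [/\ [/\ linear Delta, monoid_morphism Delta, scalar eps & monoid_morphism eps],
      [/\ Phi \is a GRing.unit,
          forall h, counit_id D (Delta h) = h
        & forall h, id_counit D (Delta h) = h],
      forall h, Phi * comul_id D (Delta h) * Phi^-1 = id_comul D (Delta h),
      id_id_comul D Phi * comul_id_id D Phi
        = one_tensor3 Phi * id_comul_id D Phi * (Phi ⊗ 1)
    & tmap (id_counit D) id Phi = 1 ⊗ 1].

Definition is_quasi_hopf D : Prop :=
  let Delta := comul D in
  let eps := counit D in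
  let Phi := associator D in
  let alpha := qalpha D in
  let beta := qbeta D in
  let S := antipode D in
  [/\ is_quasi_bialgebra D,
      [/\ bijective S, S 1 = 1 & forall x y, S (x * y) = S y * S x],
      forall h, tlift (fun a b => S a * alpha * b) (Delta h) = eps h *: alpha,
      forall h, tlift (fun a b => a * beta * S b) (Delta h) = eps h *: beta
    & tlift3 (fun x y z => x * beta * S y * alpha * z) Phi = 1 /\
      tlift3 (fun x y z => S x * alpha * y * beta * S z) Phi^-1 = 1].

Definition q_left D : tensor H H :=
  tlift3 (fun x y z => (antipode D x * qalpha D * y) ⊗ z) (associator D)^-1.

Definition p_left D : tensor H H :=
  tlift3 (fun x y z => (y * (antipode D)^-1%VF (x * qbeta D)) ⊗ z)
    (associator D).

Definition is_gauge D F : Prop :=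
  [/\ F \is a GRing.unit, counit_id D F = 1 & id_counit D F = 1].

Definition gauge_twist D F : quasi_hopf_data H := {|
  comul := fun h => F * comul D h * F^-1;
  counit := counit D;
  associator := one_tensor2 F * id_comul D F * associator D
                * comul_id D F^-1 * (F^-1 ⊗ 1);
  qalpha := tlift (fun d e => antipode D d * qalpha D * e) F^-1;
  qbeta := tlift (fun f g => f * qbeta D * antipode D g) F;
  antipode := antipode D
|}.

Definition two_sided_integral D l : Prop :=
  forall h, h * l = counit D h *: l /\ l * h = counit D h *: l.

Definition normalized_integral D l : Prop :=
  two_sided_integral D l /\ counit D l = 1.

Definition mult (t : tensor H H) : H := tlift (fun a b => a * b) t.

(* The element ν_H, as a function of the normalized integral Λ of H.           *)
Definition nu D (Lambda : H) : H := mult (q_left D * comul D Lambda * p_left D).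

Definition left_ideal (U : {vspace H}) : Prop :=
  forall h u, u \in U -> h * u \in U.

(* H is semisimple as a left module over itself: every submodule is a direct   *)
(* summand.                                                                    *)
Definition semisimple : Prop :=
  forall U : {vspace H}, left_ideal U ->
    exists W : {vspace H},
      [/\ left_ideal W, (U + W)%VS = fullv & (U :&: W)%VS = 0%VS].

End QuasiHopf.

Arguments semisimple {k} H.

(* Main.v *)
(* Write q = q_L, p = p_L, E = q Δ(Λ) p = Σ E1 ⊗ E2, so that ν = Σ E1 E2.     *)
(* Quasi-coassociativity and the antipode axioms turn hΛ = ε(h)Λ = Λh into     *)
(*   (1 ⊗ h) q Δ(Λ) = (S h ⊗ 1) q Δ(Λ),                                        *)
(*   Δ(Λ) p (1 ⊗ h) = Δ(Λ) p (S^-1 h ⊗ 1);                                     *)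
(* multiplying out Σ E1 h E2 in two ways gives S(h) ν = ν S(h), so ν is        *)
(* central. The pentagon gives                                                 *)
(*   (β ⊗ 1) q Δ(Λ) = Δ(Λ) = Δ(Λ) p (S^-1 α ⊗ 1),                              *)
(* whence Σ Λ1 Λ2 = Σ β E1 S^-1(α) E2 = β ν α. A gauge transformation F only   *)
(* multiplies q and p by factors that the two sides of F Δ(Λ) F^-1 absorb:     *)
(* q_F F Δ(Λ) = q Δ(Λ) and Δ(Λ) F^-1 p_F = Δ(Λ) p.                             *)

Require Import Defs.
From mathcomp Require Import all_boot all_algebra all_field.
Import GRing.Theory.
Local Open Scope ring_scope.

Set Implicit Arguments.
Unset Strict Implicit.
Unset Printing Implicit Defensive.

(** The integral turns coproducts into scalars: Δ(h)Δ(Λ) = ε(h)Δ(Λ) = Δ(Λ)Δ(h). The elements q_L and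
    p_L are the images of Φ^-1 and Φ under [qmap] and [pmap], which contract the first two of three
    legs through α and β. A coproduct lying on the two contracted legs becomes a counit by the
    antipode axioms ([qmap_comul_id], [pmap_comul_id]); a coproduct on legs two and three is pushed
    against Δ(Λ) and becomes a counit there ([qmap_id_comul], [pmap_id_comul]).

    All identities come from contracting an identity about Φ in this way. Quasi-coassociativity
    gives [q_left_integral] and [p_left_integral], which trade a factor h on the second leg for
    S(h), respectively S^-1(h), on the first; multiplying the legs together makes ν central
    ([nu_central]). The pentagon gives [beta_q_left] and [p_left_alpha], whence Σ Λ1 Λ2 = β ν α
    ([mult_comul_integral]), and centrality moves ν to either side of βα. The formula for Φ_F gives
    [q_left_gauge] and [p_left_gauge], where every factor coming from F cancels, hence [nu_gauge].
    Finally the integral of H_F is Λ itself, because a twist changes neither the product nor the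
    counit. *)

Section Linear.
Variables (k : fieldType) (U V W : lmodType k) (A : algType k).

(** * Linearity as a proposition about plain functions, and the tactic [lin] that proves it *)

Lemma linear_id : linear (fun x : U => x).
Proof. by []. Qed.

Lemma linear_comp (f : V -> W) (g : U -> V) :
  linear f -> linear g -> linear (fun x => f (g x)).
Proof. by move=> fl gl c x y; rewrite gl fl. Qed.

Lemma linear_Z (f : U -> V) c x : linear f -> f (c *: x) = c *: f x.
Proof.
move=> fl; rewrite -[c *: x]addr0 fl.
(* This instance reads f 0 = 0. *)
have := fl (-1) x x; rewrite !scaleN1r !addNr.
by move->; rewrite addr0.
Qed.

Lemma linear_mull (f : U -> A) a : linear f -> linear (fun x => f x * a).
Proof. by move=> fl c x y; rewrite fl mulrDl scalerAl. Qed.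

Lemma linear_mulr (f : U -> A) a : linear f -> linear (fun x => a * f x).
Proof. by move=> fl c x y; rewrite fl mulrDr scalerAr. Qed.

Lemma linear_scale (f : U -> V) c : linear f -> linear (fun x => c *: f x).
Proof. by move=> fl d x y; rewrite fl scalerDr !scalerA mulrC. Qed.

Lemma linear_scalar (e : V -> k) (f : U -> V) (v : W) :
  scalar e -> linear f -> linear (fun x => e (f x) *: v).
Proof. by move=> el fl d x y; rewrite fl el scalerDl scalerA. Qed.

End Linear.

Section PureLinear.
Variables (k : fieldType) (U : lmodType k) (A B : falgType k).

Lemma linear_purel (f : U -> A) (b : B) :
  linear f -> linear (fun x => f x ⊗ b).
Proof. by move=> fl c x y; rewrite fl pureDl pureZl. Qed.

Lemma linear_purer (f : U -> B) (a : A) :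
  linear f -> linear (fun x => a ⊗ f x).
Proof. by move=> fl c x y; rewrite fl pureDr pureZr. Qed.

End PureLinear.

Create HintDb lin discriminated.

(* Backtracking matters: a pattern variable ?v may match a term that depends   *)
(* on the bound variable, and the branch then fails.                           *)
Ltac lin :=
  match goal with
  | H : GRing.linear_for _ ?f |- GRing.linear_for _ ?f => exact H
  | |- GRing.linear_for _ (fun x => x) => apply linear_id
  | |- GRing.linear_for _ (fun x => GRing.mul (@?f x) ?v) =>
      apply (@linear_mull _ _ _ f v); lin
  | |- GRing.linear_for _ (fun x => GRing.mul ?v (@?f x)) =>
      apply (@linear_mulr _ _ _ f v); lin
  | |- GRing.linear_for _ (GRing.mul ?v) => exact (linear_mulr v (@linear_id _ _))
  | |- GRing.linear_for _ (fun x => pure (@?f x) ?v) =>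
      apply (@linear_purel _ _ _ _ f v); lin
  | |- GRing.linear_for _ (fun x => pure ?v (@?f x)) =>
      apply (@linear_purer _ _ _ _ f v); lin
  | |- GRing.linear_for _ (fun x => GRing.scale (?e (@?f x)) ?v) =>
      apply (@linear_scalar _ _ _ _ e f v); [assumption | lin]
  | |- GRing.linear_for _ (fun x => GRing.scale ?c (@?f x)) =>
      apply (@linear_scale _ _ _ f c); lin
  | |- GRing.linear_for _ ?h => solve [eauto 1 with lin nocore | exact: linearP]
  | |- GRing.linear_for _ (fun x => ?h (@?f x)) =>
      apply (@linear_comp _ _ _ _ h f); lin
  end.

#[local] Hint Resolve tlift_is_linear : lin.

(** * Linear maps and algebra maps on tensor products *)

Section TensorMaps.
Variables (k : fieldType) (A B C A' B' : falgType k) (V : lmodType k).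

Lemma tmap_linear (f : A -> A') (g : B -> B') : linear (tmap f g).
Proof. exact: tlift_is_linear. Qed.

Lemma tassoc_linear : linear (@tassoc k A B C).
Proof. exact: tlift_is_linear. Qed.

Lemma tlift3_linear (f : A -> B -> C -> V) : linear (tlift3 f).
Proof. exact: tlift_is_linear. Qed.

Lemma tensor3_eq_lin (f g : tensor (tensor A B) C -> V) :
    linear f -> linear g -> (forall a b c, f (a ⊗ b ⊗ c) = g (a ⊗ b ⊗ c)) ->
  f =1 g.
Proof.
move=> fl gl fg; apply: tensor_eq_lin => // u c; move: u.
by apply: tensor_eq_lin => [||a b] //; lin.
Qed.

End TensorMaps.

#[local] Hint Resolve tmap_linear tassoc_linear tlift3_linear : lin.

Section MonoidMorphism.
Variable k : fieldType.

Lemma comp_monoid_morphism (R S T : pzSemiRingType) (f : S -> T) (g : R -> S) :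
  monoid_morphism f -> monoid_morphism g -> monoid_morphism (fun x => f (g x)).
Proof. by move=> [f1 fM] [g1 gM]; split=> [|x y]; rewrite ?g1 ?gM. Qed.

Lemma monoid_morphismV (R S : unitRingType) (f : R -> S) x :
    monoid_morphism f -> x \is a GRing.unit ->
  f x \is a GRing.unit /\ (f x)^-1 = f x^-1.
Proof.
move=> [f1 fM] Ux; have fV: f x * f x^-1 = 1 by rewrite -fM divrr.
have Vf: f x^-1 * f x = 1 by rewrite -fM mulVr.
have Ufx: f x \is a GRing.unit by apply/unitrP; exists (f x^-1).
by split=> //; apply: (mulrI Ufx); rewrite divrr.
Qed.

Lemma tensor_monoid_morphism (A B : falgType k) (R : algType k)
    (f : tensor A B -> R) :
    linear f -> f (1 ⊗ 1) = 1 ->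
    (forall a b a' b', f ((a * a') ⊗ (b * b')) = f (a ⊗ b) * f (a' ⊗ b')) ->
  monoid_morphism f.
Proof.
move=> fl f1 fM; split=> // s t; move: s.
apply: tensor_eq_lin => [||a b]; [lin | lin |].
by move: t; apply: tensor_eq_lin => [||a' b']; [lin | lin | rewrite pureM fM].
Qed.

Lemma tensor3_monoid_morphism (A B C : falgType k) (R : algType k)
    (f : tensor (tensor A B) C -> R) :
    linear f -> f (1 ⊗ 1 ⊗ 1) = 1 ->
    (forall a b c a' b' c',
       f ((a * a') ⊗ (b * b') ⊗ (c * c')) = f (a ⊗ b ⊗ c) * f (a' ⊗ b' ⊗ c')) ->
  monoid_morphism f.
Proof.
move=> fl f1 fM; split=> // s t; move: s.
apply: tensor3_eq_lin => [||a b c]; [lin | lin |].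
move: t; apply: tensor3_eq_lin => [||a' b' c']; [lin | lin |].
by rewrite !pureM fM.
Qed.

Variables A B C A' B' : falgType k.

Lemma tmap_monoid_morphism (f : A -> A') (g : B -> B') :
    linear f -> monoid_morphism f -> linear g -> monoid_morphism g ->
  monoid_morphism (tmap f g).
Proof.
move=> fl [f1 fM] gl [g1 gM]; apply: tensor_monoid_morphism; first lin.
  by rewrite tmap_pure // f1 g1.
by move=> *; rewrite !tmap_pure // fM gM pureM.
Qed.

Lemma tassoc_monoid_morphism : monoid_morphism (@tassoc k A B C).
Proof.
split; first by rewrite !pure11 tassoc_pure.
move=> s t; move: s; apply: tensor_eq_lin => [||a u]; [lin | lin |].
move: u; apply: tensor_eq_lin => [||b c]; [lin | lin |].
move: t; apply: tensor_eq_lin => [||a' u]; [lin | lin |].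
move: u; apply: tensor_eq_lin => [||b' c']; [lin | lin |].
by rewrite !(pureM, tassoc_pure).
Qed.

Lemma pure1l_monoid_morphism : monoid_morphism (fun b : B => (1 : A) ⊗ b).
Proof. by split=> // b b'; rewrite pureM mulr1. Qed.

Lemma pure1r_monoid_morphism : monoid_morphism (fun a : A => a ⊗ (1 : B)).
Proof. by split=> // a a'; rewrite pureM mulr1. Qed.

End MonoidMorphism.

(** * Counit normalizations of the associator *)

Section QuasiHopf.
Variables (k : fieldType) (H : falgType k) (D : quasi_hopf_data H).
Hypothesis HD : is_quasi_hopf D.

Let comul_linear : linear (comul D). Proof. by case: HD => -[[]]. Qed.
Let comul_mor : monoid_morphism (comul D). Proof. by case: HD => -[[]]. Qed.
Let counit_scalar : scalar (counit D). Proof. by case: HD => -[[]]. Qed.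
Let counit_mor : monoid_morphism (counit D). Proof. by case: HD => -[[]]. Qed.

Lemma counit_id_linear : linear (counit_id D).
Proof. exact: tlift_is_linear. Qed.

Lemma id_counit_linear : linear (id_counit D).
Proof. exact: tlift_is_linear. Qed.

#[local] Hint Resolve comul_linear counit_id_linear id_counit_linear : lin.

Lemma comul_id_linear : linear (comul_id D).
Proof. exact: tlift_is_linear. Qed.

Lemma id_comul_linear : linear (id_comul D).
Proof. by rewrite /id_comul; lin. Qed.

#[local] Hint Resolve comul_id_linear id_comul_linear : lin.

Lemma comul_id_id_linear : linear (comul_id_id D).
Proof. exact: tlift_is_linear. Qed.

Lemma id_comul_id_linear : linear (id_comul_id D).
Proof. exact: tlift_is_linear. Qed.

Lemma id_id_comul_linear : linear (id_id_comul D).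
Proof. by rewrite /id_id_comul; lin. Qed.

Lemma one_tensor2_linear : linear (@one_tensor2 k H).
Proof. by rewrite /one_tensor2; lin. Qed.

Lemma one_tensor3_linear : linear (@one_tensor3 k H).
Proof. by rewrite /one_tensor3; lin. Qed.

Definition id_id_counit (t : tensor (tensor H H) H) : tensor H H :=
  tlift (fun u c => counit D c *: u) t.

Definition counit_id_id (t : tensor (tensor H H) H) : tensor H H :=
  tlift3 (fun a b c => counit D a *: (b ⊗ c)) t.

Lemma id_id_counit_linear : linear id_id_counit.
Proof. exact: tlift_is_linear. Qed.

Lemma counit_id_id_linear : linear counit_id_id.
Proof. exact: tlift_is_linear. Qed.

#[local] Hint Resolve comul_id_id_linear id_comul_id_linear id_id_comul_linear
  one_tensor2_linear one_tensor3_linear id_id_counit_linear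
  counit_id_id_linear : lin.

Lemma counit_id_pure a b : counit_id D (a ⊗ b) = counit D a *: b.
Proof. by rewrite /counit_id tlift_pure => [|?|?] //; lin. Qed.

Lemma id_counit_pure a b : id_counit D (a ⊗ b) = counit D b *: a.
Proof. by rewrite /id_counit tlift_pure => [|?|?] //; lin. Qed.

Lemma comul_id_pure a b : comul_id D (a ⊗ b) = comul D a ⊗ b.
Proof. by rewrite /comul_id tmap_pure //; lin. Qed.

Lemma id_comul_pure a b : id_comul D (a ⊗ b) = tassoc (a ⊗ comul D b).
Proof. by rewrite /id_comul tmap_pure //; lin. Qed.

Lemma comul_id_id_pure a b c :
  comul_id_id D (a ⊗ b ⊗ c) = comul D a ⊗ b ⊗ c.
Proof. by rewrite /comul_id_id tmap_pure ?comul_id_pure //; lin. Qed.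

Lemma id_comul_id_pure a b c :
  id_comul_id D (a ⊗ b ⊗ c) = tassoc (a ⊗ comul D b) ⊗ c.
Proof. by rewrite /id_comul_id tmap_pure ?id_comul_pure //; lin. Qed.

Lemma id_id_comul_pure u c :
  id_id_comul D (u ⊗ c) = tassoc (u ⊗ comul D c).
Proof. by rewrite /id_id_comul tmap_pure //; lin. Qed.

Lemma one_tensor2_pure (a b : H) : one_tensor2 (a ⊗ b) = 1 ⊗ a ⊗ b.
Proof. exact: tassoc_pure. Qed.

Lemma one_tensor3_pure (a b c : H) :
  one_tensor3 (a ⊗ b ⊗ c) = 1 ⊗ a ⊗ b ⊗ c.
Proof.
by rewrite /one_tensor3 tassoc_pure tmap_pure ?tassoc_pure //; lin.
Qed.

Lemma id_id_counit_pure u c : id_id_counit (u ⊗ c) = counit D c *: u.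
Proof. by rewrite /id_id_counit tlift_pure => [|?|?] //; lin. Qed.

Lemma counit_id_id_pure a b c :
  counit_id_id (a ⊗ b ⊗ c) = counit D a *: (b ⊗ c).
Proof. by rewrite /counit_id_id tlift3_pure => [|? ?|? ?|? ?] //; lin. Qed.

Lemma counit_id_mor : monoid_morphism (counit_id D).
Proof.
case: counit_mor => e1 eM; apply: tensor_monoid_morphism; first lin.
  by rewrite counit_id_pure e1 scale1r.
by move=> a b a' b'; rewrite !counit_id_pure eM -scalerAl -scalerAr scalerA.
Qed.

Lemma id_counit_mor : monoid_morphism (id_counit D).
Proof.
case: counit_mor => e1 eM; apply: tensor_monoid_morphism; first lin.
  by rewrite id_counit_pure e1 scale1r.
by move=> a b a' b'; rewrite !id_counit_pure eM -scalerAl -scalerAr scalerA.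
Qed.

Lemma id_id_counit_mor : monoid_morphism id_id_counit.
Proof.
case: counit_mor => e1 eM; apply: tensor_monoid_morphism; first lin.
  by rewrite id_id_counit_pure e1 scale1r.
by move=> a b a' b'; rewrite !id_id_counit_pure eM -scalerAl -scalerAr scalerA.
Qed.

Lemma counit_id_id_mor : monoid_morphism counit_id_id.
Proof.
case: counit_mor => e1 eM; apply: tensor3_monoid_morphism; first lin.
  by rewrite counit_id_id_pure e1 scale1r.
move=> *; rewrite !counit_id_id_pure eM -scalerAl -scalerAr scalerA.
by rewrite pureM.
Qed.

Lemma comul_id_mor : monoid_morphism (comul_id D).
Proof. by apply: tmap_monoid_morphism => //; lin. Qed.

Lemma id_comul_mor : monoid_morphism (id_comul D).
Proof.
apply: comp_monoid_morphism; first exact: tassoc_monoid_morphism.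
by apply: tmap_monoid_morphism => //; lin.
Qed.

Lemma comul_id_id_mor : monoid_morphism (comul_id_id D).
Proof. by apply: tmap_monoid_morphism; [lin|exact: comul_id_mor|lin|]. Qed.

Lemma id_comul_id_mor : monoid_morphism (id_comul_id D).
Proof. by apply: tmap_monoid_morphism; [lin|exact: id_comul_mor|lin|]. Qed.

Lemma id_id_comul_mor : monoid_morphism (id_id_comul D).
Proof.
apply: comp_monoid_morphism; first exact: tassoc_monoid_morphism.
by apply: tmap_monoid_morphism => //; lin.
Qed.

Lemma one_tensor2_mor : monoid_morphism (@one_tensor2 k H).
Proof.
apply: comp_monoid_morphism; first exact: tassoc_monoid_morphism.
exact: pure1l_monoid_morphism.
Qed.

Lemma one_tensor3_mor : monoid_morphism (@one_tensor3 k H).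
Proof.
apply: comp_monoid_morphism.
  by apply: tmap_monoid_morphism;
     [lin | exact: tassoc_monoid_morphism | lin |].
apply: comp_monoid_morphism; first exact: tassoc_monoid_morphism.
exact: pure1l_monoid_morphism.
Qed.

Let Phi_unit : associator D \is a GRing.unit.
Proof. by case: HD => -[_ []]. Qed.

Let pentagon : id_id_comul D (associator D) * comul_id_id D (associator D) =
  one_tensor3 (associator D) * id_comul_id D (associator D)
    * (associator D ⊗ 1).
Proof. by case: HD => -[]. Qed.

Let counitl h : counit_id D (comul D h) = h.
Proof. by case: HD => -[_ []]. Qed.

Let counitr h : id_counit D (comul D h) = h.
Proof. by case: HD => -[_ []]. Qed.

Let Phi_counit : tmap (id_counit D) id (associator D) = 1 ⊗ 1.
Proof. by case: HD => -[]. Qed.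

Let counit2 := tmap (tmap (id_counit D) (@id H)) (@id H).
Let counit3 := tmap id_id_counit (@id H).
Let counit_mid := tmap (id_counit D) (@id H).

Let counit2_linear : linear counit2. Proof. exact: tlift_is_linear. Qed.
Let counit3_linear : linear counit3. Proof. exact: tlift_is_linear. Qed.
Let counit_mid_linear : linear counit_mid. Proof. exact: tlift_is_linear. Qed.
#[local] Hint Resolve counit2_linear counit3_linear counit_mid_linear : lin.

Let counit_mid_pure a b c : counit_mid (a ⊗ b ⊗ c) = counit D b *: (a ⊗ c).
Proof. by rewrite /counit_mid tmap_pure ?id_counit_pure ?pureZl //; lin. Qed.

Let counit2_pure a b c d :
  counit2 (a ⊗ b ⊗ c ⊗ d) = counit D b *: (a ⊗ c ⊗ d).
Proof.
rewrite /counit2 tmap_pure; [|lin|lin].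
by rewrite tmap_pure ?id_counit_pure ?pureZl //; lin.
Qed.

Let counit3_pure u c d : counit3 (u ⊗ c ⊗ d) = counit D c *: (u ⊗ d).
Proof. by rewrite /counit3 tmap_pure ?id_id_counit_pure ?pureZl //; lin. Qed.

(** With ε applied to the third of its four legs, and (id ⊗ ε ⊗ id)(Φ) = 1 removing two factors, the
    pentagon becomes Φ = Φ ((id ⊗ id ⊗ ε)(Φ) ⊗ 1); then Φ cancels. *)
Lemma id_id_counit_associator : id_id_counit (associator D) = 1.
Proof.
have [_ G3M]: monoid_morphism counit3.
  by apply: tmap_monoid_morphism; [lin|exact: id_id_counit_mor|lin|].
have G1 v : counit3 (id_id_comul D v) = v.
  move: v; apply: tensor_eq_lin => [||u c]; [lin|lin|].
  rewrite id_id_comul_pure -{2}[c]counitl.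
  move: (comul D c); apply: tensor_eq_lin => [||c1 c2]; [lin|lin|].
  by rewrite tassoc_pure counit3_pure counit_id_pure pureZr.
have G2 v : counit3 (comul_id_id D v) = comul_id D (counit_mid v).
  move: v; apply: tensor3_eq_lin => [||a b c]; [lin|lin|].
  rewrite comul_id_id_pure counit3_pure counit_mid_pure.
  by rewrite linear_Z ?comul_id_pure //; lin.
have G4 v : counit3 (one_tensor3 v) = one_tensor2 (counit_mid v).
  move: v; apply: tensor3_eq_lin => [||a b c]; [lin|lin|].
  rewrite one_tensor3_pure counit3_pure counit_mid_pure.
  by rewrite linear_Z ?one_tensor2_pure //; lin.
have G5 v : counit3 (id_comul_id D v) = v.
  move: v; apply: tensor3_eq_lin => [||a b c]; [lin|lin|].
  rewrite id_comul_id_pure -{2}[b]counitr.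
  move: (comul D b); apply: tensor_eq_lin => [||b1 b2]; [lin|lin|].
  by rewrite tassoc_pure counit3_pure id_counit_pure pureZr pureZl.
have G6 v : counit3 (v ⊗ 1) = id_id_counit v ⊗ 1.
  by rewrite /counit3 tmap_pure //; lin.
have := congr1 counit3 pentagon; rewrite !G3M G1 G2 G4 G5 G6.
rewrite /counit_mid Phi_counit -pure11.
rewrite (fst comul_id_mor) (fst one_tensor2_mor) mulr1 mul1r => E.
have: id_id_counit (associator D) ⊗ 1 = 1 :> tensor (tensor H H) H.
  by apply: (mulrI Phi_unit); rewrite -E mulr1.
(* A further id ⊗ id ⊗ ε strips the spare leg 1, since ε(1) = 1. *)
move/(congr1 id_id_counit); rewrite id_id_counit_pure (fst counit_mor).
by rewrite scale1r (fst id_id_counit_mor).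
Qed.

(** Here ε is applied to the second leg, and the pentagon becomes Φ = (1 ⊗ (ε ⊗ id ⊗ id)(Φ)) Φ. *)
Lemma counit_id_id_associator : counit_id_id (associator D) = 1.
Proof.
have [_ G2M]: monoid_morphism counit2.
  apply: tmap_monoid_morphism; [lin| |lin|by []].
  by apply: tmap_monoid_morphism; [lin|exact: id_counit_mor|lin|].
have G1 v : counit2 (id_id_comul D v) = id_comul D (counit_mid v).
  move: v; apply: tensor3_eq_lin => [||a b c]; [lin|lin|].
  rewrite id_id_comul_pure counit_mid_pure linear_Z ?id_comul_pure; last lin.
  move: (comul D c); apply: tensor_eq_lin => [||c1 c2]; [lin|lin|].
  by rewrite !tassoc_pure counit2_pure.
have G2 v : counit2 (comul_id_id D v) = v.
  move: v; apply: tensor3_eq_lin => [||a b c]; [lin|lin|].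
  rewrite comul_id_id_pure -{2}[a]counitr.
  move: (comul D a); apply: tensor_eq_lin => [||a1 a2]; [lin|lin|].
  by rewrite counit2_pure id_counit_pure !pureZl.
have G4 v : counit2 (one_tensor3 v) = one_tensor2 (counit_id_id v).
  move: v; apply: tensor3_eq_lin => [||a b c]; [lin|lin|].
  rewrite one_tensor3_pure counit2_pure counit_id_id_pure.
  by rewrite linear_Z ?one_tensor2_pure //; lin.
have G5 v : counit2 (id_comul_id D v) = v.
  move: v; apply: tensor3_eq_lin => [||a b c]; [lin|lin|].
  rewrite id_comul_id_pure -{2}[b]counitl.
  move: (comul D b); apply: tensor_eq_lin => [||b1 b2]; [lin|lin|].
  by rewrite tassoc_pure counit2_pure counit_id_pure pureZr pureZl.
have G6 v : counit2 (v ⊗ 1) = counit_mid v ⊗ 1.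
  by rewrite /counit2 tmap_pure //; lin.
have := congr1 counit2 pentagon; rewrite !G2M G1 G2 G4 G5 G6.
rewrite /counit_mid Phi_counit -!pure11.
rewrite (fst id_comul_mor) mulr1 mul1r => E.
have: one_tensor2 (counit_id_id (associator D)) = 1.
  by apply: (mulIr Phi_unit); rewrite -E mul1r.
move/(congr1 counit_id_id); rewrite (fst counit_id_id_mor) => <-.
move: (counit_id_id _); apply: tensor_eq_lin => [||b c]; [lin|lin|].
by rewrite one_tensor2_pure counit_id_id_pure (fst counit_mor) scale1r.
Qed.

(** * Partial evaluations with the antipode *)

Let SM x y : antipode D (x * y) = antipode D y * antipode D x.
Proof. by case: HD => _ [_ _ ->]. Qed.

Let S1 : antipode D 1 = 1.
Proof. by case: HD => _ []. Qed.

(** The inverse of S in [p_left] is the inverse of a linear endomorphism; injectivity of S makes it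
    a genuine two-sided inverse. *)
Let lkerS : lker (antipode D) == 0%VS.
Proof. by apply/lker0P/bij_inj; case: HD => _ []. Qed.

Notation S' := (antipode D)^-1%VF.

Let SK : cancel (antipode D) S'. Proof. exact: lker0_lfunK. Qed.
Let S'K : cancel S' (antipode D). Proof. exact: lker0_lfunVK. Qed.

Let S'M x y : S' (x * y) = S' y * S' x.
Proof. by apply: (can_inj SK); rewrite SM !S'K. Qed.

Let S'1 : S' 1 = 1.
Proof. by rewrite -{1}S1 SK. Qed.

(** A right action of H ⊗ H on H, as [act_beta] is a left one. In these terms α_F is α acted on by
    F^-1, β_F is β acted on by F, and the antipode axioms say that Δ(h) acts on α and on β as
    ε(h). *)
Definition act_alpha (al : H) (t : tensor H H) : H :=
  tlift (fun a b => antipode D a * al * b) t.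

Definition act_beta (be : H) (t : tensor H H) : H :=
  tlift (fun a b => a * be * antipode D b) t.

Lemma act_alpha_linear al : linear (act_alpha al).
Proof. exact: tlift_is_linear. Qed.

Lemma act_beta_linear be : linear (act_beta be).
Proof. exact: tlift_is_linear. Qed.

#[local] Hint Resolve act_alpha_linear act_beta_linear : lin.

Lemma act_alpha_pure al a b : act_alpha al (a ⊗ b) = antipode D a * al * b.
Proof. by rewrite /act_alpha tlift_pure => [|?|?] //; lin. Qed.

Lemma act_beta_pure be a b : act_beta be (a ⊗ b) = a * be * antipode D b.
Proof. by rewrite /act_beta tlift_pure => [|?|?] //; lin. Qed.

Lemma act_alpha_mul al s t : act_alpha al (s * t) = act_alpha (act_alpha al s) t.
Proof.
move: t; apply: tensor_eq_lin => [||x y]; [lin|lin|].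
rewrite act_alpha_pure; move: s; apply: tensor_eq_lin => [||a b]; [lin|lin|].
by rewrite pureM !act_alpha_pure SM !mulrA.
Qed.

Lemma act_beta_mul be s t : act_beta be (s * t) = act_beta (act_beta be t) s.
Proof.
move: s; apply: tensor_eq_lin => [||x y]; [lin|lin|].
rewrite act_beta_pure; move: t; apply: tensor_eq_lin => [||a b]; [lin|lin|].
by rewrite pureM !act_beta_pure SM !mulrA.
Qed.

Let alpha_comul h :
  act_alpha (qalpha D) (comul D h) = counit D h *: qalpha D.
Proof. case: HD => _ _ A _ _; exact: A. Qed.

Let beta_comul h : act_beta (qbeta D) (comul D h) = counit D h *: qbeta D.
Proof. case: HD => _ _ _ B _; exact: B. Qed.

(** The middle element is a parameter, so that the same map gives q_L of H from α and q_L of H_F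
    from α_F; likewise for [pmap]. *)
Definition qmap (al : H) (u : tensor (tensor H H) H) : tensor H H :=
  tlift3 (fun x y z => (antipode D x * al * y) ⊗ z) u.

Definition pmap (be : H) (u : tensor (tensor H H) H) : tensor H H :=
  tlift3 (fun x y z => (y * S' (x * be)) ⊗ z) u.

Lemma qmap_linear al : linear (qmap al).
Proof. exact: tlift_is_linear. Qed.

Lemma pmap_linear be : linear (pmap be).
Proof. exact: tlift_is_linear. Qed.

#[local] Hint Resolve qmap_linear pmap_linear : lin.

Lemma qmap_pure al t z : qmap al (t ⊗ z) = act_alpha al t ⊗ z.
Proof.
move: t; apply: tensor_eq_lin => [||x y]; [lin|lin|].
by rewrite /qmap tlift3_pure ?act_alpha_pure // => ? ?; lin.
Qed.

(* y S^-1(x β) = S^-1(x β S(y)) *)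
Lemma pmap_pure be t z : pmap be (t ⊗ z) = S' (act_beta be t) ⊗ z.
Proof.
move: t; apply: tensor_eq_lin => [||x y]; [lin|lin|].
rewrite /pmap tlift3_pure => [|? ?|? ?|? ?]; [|lin|lin|lin].
by rewrite act_beta_pure [S' (_ * antipode D y)]S'M SK.
Qed.

(** A left factor reaches α first, as S(ax) α by = S(x) (S(a) α b) y. *)
Lemma qmap_comul_id t u :
  qmap (qalpha D) (comul_id D t * u) = 1 ⊗ counit_id D t * qmap (qalpha D) u.
Proof.
move: t; apply: tensor_eq_lin => [||a b]; [lin|lin|].
move: u; apply: tensor_eq_lin => [||v z]; [lin|lin|].
rewrite comul_id_pure counit_id_pure pureM !qmap_pure act_alpha_mul alpha_comul.
rewrite pureM mul1r -scalerAl pureZr -pureZl; congr (_ ⊗ _).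
move: v; apply: tensor_eq_lin => [||x y]; [lin|lin|].
by rewrite !act_alpha_pure -scalerAr -scalerAl.
Qed.

(** The contracted leg is S^-1(x β S(y)), so here it is a right factor that reaches β first. *)
Lemma pmap_comul_id t u :
  pmap (qbeta D) (u * comul_id D t) = pmap (qbeta D) u * (1 ⊗ counit_id D t).
Proof.
move: t; apply: tensor_eq_lin => [||a b]; [lin|lin|].
move: u; apply: tensor_eq_lin => [||v z]; [lin|lin|].
rewrite comul_id_pure counit_id_pure pureM !pmap_pure act_beta_mul beta_comul.
rewrite pureM mulr1 -scalerAr pureZr -pureZl; congr (_ ⊗ _).
move: v; apply: tensor_eq_lin => [||x y]; [lin|lin|].
by rewrite !act_beta_pure -scalerAr -scalerAl linear_Z //; lin.
Qed.

Lemma qmap_pure1 al s u : qmap al ((s ⊗ 1) * u) = qmap (act_alpha al s) u.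
Proof.
move: u; apply: tensor_eq_lin => [||v z]; [lin|lin|].
by rewrite pureM !qmap_pure act_alpha_mul mul1r.
Qed.

Lemma pmap_pure1 be s u : pmap be (u * (s ⊗ 1)) = pmap (act_beta be s) u.
Proof.
move: u; apply: tensor_eq_lin => [||v z]; [lin|lin|].
by rewrite pureM !pmap_pure act_beta_mul mulr1.
Qed.

Lemma qmap_one_tensor2 al t u : qmap al (u * one_tensor2 t) = qmap al u * t.
Proof.
move: t; apply: tensor_eq_lin => [||a b]; [lin|lin|].
move: u; apply: tensor3_eq_lin => [||x y z]; [lin|lin|].
rewrite one_tensor2_pure !pureM !qmap_pure !act_alpha_pure pureM.
by rewrite mulr1 !mulrA.
Qed.

Lemma pmap_one_tensor2 be t u : pmap be (one_tensor2 t * u) = t * pmap be u.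
Proof.
move: t; apply: tensor_eq_lin => [||a b]; [lin|lin|].
move: u; apply: tensor3_eq_lin => [||x y z]; [lin|lin|].
rewrite one_tensor2_pure !pureM !pmap_pure !act_beta_pure pureM.
by rewrite mul1r SM !S'M !SK !mulrA.
Qed.

(** Right factors land outside the contraction: S(xa) = S(a) S(x) sends a to the far left, while s
    stays on the right, where Δ(Λ) can meet it. *)
Lemma qmap_tassoc al a s u :
  qmap al (u * tassoc (a ⊗ s)) = antipode D a ⊗ 1 * (qmap al u * s).
Proof.
move: s; apply: tensor_eq_lin => [||b1 b2]; [lin|lin|].
move: u; apply: tensor3_eq_lin => [||x y z]; [lin|lin|].
rewrite tassoc_pure !pureM !qmap_pure !act_alpha_pure !pureM.
by rewrite SM mul1r !mulrA.
Qed.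

Lemma pmap_tassoc be a s u :
  pmap be (tassoc (a ⊗ s) * u) = s * pmap be u * (S' a ⊗ 1).
Proof.
move: s; apply: tensor_eq_lin => [||b1 b2]; [lin|lin|].
move: u; apply: tensor3_eq_lin => [||x y z]; [lin|lin|].
rewrite tassoc_pure !pureM !pmap_pure !act_beta_pure !pureM.
by rewrite SM !S'M !SK mulr1 !mulrA.
Qed.

(* R (a ⊗ b ⊗ c ⊗ d) = a β S(b) α c ⊗ d and, as S^-1 reverses products,        *)
(* R' (a ⊗ b ⊗ c ⊗ d) = c S^-1(S(a) α b β) ⊗ d. Applied to the two              *)
(* rearrangements of the pentagon below, they collapse one side to 1 ⊗ 1.      *)
Let T := tlift3 (fun x y z =>
  x * qbeta D * antipode D y * qalpha D * z).
Let T' := tlift3 (fun x y z =>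
  antipode D x * qalpha D * y * qbeta D * antipode D z).

Let T_linear : linear T. Proof. exact: tlift_is_linear. Qed.
Let T'_linear : linear T'. Proof. exact: tlift_is_linear. Qed.
#[local] Hint Resolve T_linear T'_linear : lin.

Let T_pure t z : T (t ⊗ z) = act_beta (qbeta D) t * qalpha D * z.
Proof.
move: t; apply: tensor_eq_lin => [||x y]; [lin|lin|].
by rewrite /T tlift3_pure ?act_beta_pure // => ? ?; lin.
Qed.

Let T'_pure t z :
  T' (t ⊗ z) = act_alpha (qalpha D) t * qbeta D * antipode D z.
Proof.
move: t; apply: tensor_eq_lin => [||x y]; [lin|lin|].
by rewrite /T' tlift3_pure ?act_alpha_pure // => ? ?; lin.
Qed.

Let T_tassoc x t : T (tassoc (x ⊗ t)) = x * qbeta D * act_alpha (qalpha D) t.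
Proof.
move: t; apply: tensor_eq_lin => [||y z]; [lin|lin|].
by rewrite tassoc_pure T_pure act_beta_pure act_alpha_pure !mulrA.
Qed.

Let T'_tassoc x t :
  T' (tassoc (x ⊗ t)) = antipode D x * qalpha D * act_beta (qbeta D) t.
Proof.
move: t; apply: tensor_eq_lin => [||y z]; [lin|lin|].
by rewrite tassoc_pure T'_pure act_beta_pure act_alpha_pure !mulrA.
Qed.

Let R := tmap T (@id H).
Let R' := tmap (fun u => S' (T' u)) (@id H).

Let R_linear : linear R. Proof. exact: tlift_is_linear. Qed.
Let R'_linear : linear R'. Proof. exact: tlift_is_linear. Qed.
#[local] Hint Resolve R_linear R'_linear : lin.

Let R_pure u d : R (u ⊗ d) = T u ⊗ d.
Proof. by rewrite /R tmap_pure //; lin. Qed.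

Let R'_pure u d : R' (u ⊗ d) = S' (T' u) ⊗ d.
Proof. by rewrite /R' tmap_pure //; lin. Qed.

Let R_comul_id_id u v : R (u * comul_id_id D v) = R u * counit_id_id v.
Proof.
move: v; apply: tensor3_eq_lin => [||a b c]; [lin|lin|].
move: u; apply: tensor_eq_lin => [||u w]; [lin|lin|].
move: u; apply: tensor3_eq_lin => [||x y z]; [lin|lin|].
rewrite comul_id_id_pure counit_id_id_pure -scalerAr !pureM !R_pure !T_pure.
rewrite act_beta_mul beta_comul !act_beta_pure pureM.
by rewrite -scalerAr -!scalerAl pureZl !mulrA.
Qed.

Let R'_comul_id_id u v : R' (comul_id_id D v * u) = counit_id_id v * R' u.
Proof.
move: v; apply: tensor3_eq_lin => [||a b c]; [lin|lin|].
move: u; apply: tensor_eq_lin => [||u w]; [lin|lin|].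
move: u; apply: tensor3_eq_lin => [||x y z]; [lin|lin|].
rewrite comul_id_id_pure counit_id_id_pure -scalerAl !pureM !R'_pure !T'_pure.
rewrite act_alpha_mul alpha_comul !act_alpha_pure pureM.
rewrite -scalerAr -!scalerAl linear_Z ?pureZl; last lin.
by rewrite SM !S'M !SK !mulrA.
Qed.

Let R_id_comul_id u v : R (id_comul_id D v * u) = counit_mid v * R u.
Proof.
move: v; apply: tensor3_eq_lin => [||a b c]; [lin|lin|].
move: u; apply: tensor_eq_lin => [||u w]; [lin|lin|].
move: u; apply: tensor3_eq_lin => [||x y z]; [lin|lin|].
rewrite id_comul_id_pure counit_mid_pure -scalerAl !pureM !R_pure.
(* Rebracketed as a ⊗ (b1 ⊗ b2), the middle coproduct meets the factor S(y) α z of [T] and is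
   absorbed by α. *)
rewrite -tassoc_pure -(snd (tassoc_monoid_morphism _ _ _)) pureM !T_tassoc.
rewrite act_alpha_mul alpha_comul !act_alpha_pure pureM.
by rewrite -scalerAr -!scalerAl -scalerAr pureZl !mulrA.
Qed.

Let R'_id_comul_id u v : R' (u * id_comul_id D v) = R' u * counit_mid v.
Proof.
move: v; apply: tensor3_eq_lin => [||a b c]; [lin|lin|].
move: u; apply: tensor_eq_lin => [||u w]; [lin|lin|].
move: u; apply: tensor3_eq_lin => [||x y z]; [lin|lin|].
rewrite id_comul_id_pure counit_mid_pure -scalerAr !pureM !R'_pure.
rewrite -tassoc_pure -(snd (tassoc_monoid_morphism _ _ _)) pureM !T'_tassoc.
rewrite act_beta_mul beta_comul !act_beta_pure pureM.
rewrite -scalerAr -!scalerAl -scalerAr linear_Z ?pureZl; last lin.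
by rewrite SM !S'M !SK !mulrA.
Qed.

(** This is where q_L emerges: a β S(xb) α yc = (a β S(b)) (S(x) α y) c. *)
Let R_one_tensor3 u t s :
  R (one_tensor3 u * tassoc (t ⊗ s))
    = act_beta (qbeta D) t ⊗ 1 * (qmap (qalpha D) u * s).
Proof.
move: t; apply: tensor_eq_lin => [||a b]; [lin|lin|].
move: s; apply: tensor_eq_lin => [||c d]; [lin|lin|].
move: u; apply: tensor3_eq_lin => [||x y z]; [lin|lin|].
rewrite one_tensor3_pure tassoc_pure !pureM R_pure T_pure qmap_pure !pureM.
by rewrite !act_beta_pure act_alpha_pure !mul1r SM !mulrA.
Qed.

(** This is where p_L emerges: cy S^-1(S(a) α bx β) = c (y S^-1(x β)) S^-1(S(a) α b). *)
Let R'_one_tensor3 u t s :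
  R' (tassoc (t ⊗ s) * one_tensor3 u)
    = s * pmap (qbeta D) u * (S' (act_alpha (qalpha D) t) ⊗ 1).
Proof.
move: t; apply: tensor_eq_lin => [||a b]; [lin|lin|].
move: s; apply: tensor_eq_lin => [||c d]; [lin|lin|].
move: u; apply: tensor3_eq_lin => [||x y z]; [lin|lin|].
rewrite one_tensor3_pure tassoc_pure !pureM R'_pure T'_pure pmap_pure !pureM.
by rewrite act_beta_pure !act_alpha_pure !mulr1 SM !S'M !SK !mulrA.
Qed.

(** * Integrals and gauge transformations *)

Notation al := (qalpha D).
Notation be := (qbeta D).
Notation Phi := (associator D).

Let invV (K : falgType k) (f : tensor (tensor H H) H -> K) :
  monoid_morphism f -> f Phi = 1 -> f Phi^-1 = 1.
Proof. by move=> /monoid_morphismV/(_ Phi_unit)[_ <-] ->; rewrite invr1. Qed.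

Variable Lambda : H.
Hypothesis HL : two_sided_integral D Lambda.

Let comul_Lambdal h : comul D h * comul D Lambda = counit D h *: comul D Lambda.
Proof. by rewrite -(snd comul_mor) (HL h).1 linear_Z. Qed.

Let comul_Lambdar h : comul D Lambda * comul D h = counit D h *: comul D Lambda.
Proof. by rewrite -(snd comul_mor) (HL h).2 linear_Z. Qed.

Lemma qmap_id_comul a t u :
  qmap a (u * id_comul D t) * comul D Lambda
    = antipode D (id_counit D t) ⊗ 1 * (qmap a u * comul D Lambda).
Proof.
move: t; apply: tensor_eq_lin => [||x y]; [lin|lin|].
rewrite id_comul_pure qmap_tassoc id_counit_pure -!mulrA comul_Lambdal.
by rewrite linearZ pureZl -scalerAl -!scalerAr.
Qed.

Lemma pmap_id_comul b t u :
  comul D Lambda * pmap b (id_comul D t * u)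
    = comul D Lambda * pmap b u * (S' (id_counit D t) ⊗ 1).
Proof.
move: t; apply: tensor_eq_lin => [||x y]; [lin|lin|].
rewrite id_comul_pure pmap_tassoc id_counit_pure !mulrA comul_Lambdar.
by rewrite linearZ pureZl -!scalerAl -!scalerAr.
Qed.

(** * The elements q_L and p_L next to Δ(Λ) *)

Let q := q_left D.
Let p := p_left D.

(** Both sides are the [qmap] of Φ^-1 (id ⊗ Δ)Δ(h) = (Δ ⊗ id)Δ(h) Φ^-1, multiplied by Δ(Λ). *)
Lemma q_left_integral h :
  1 ⊗ h * (q * comul D Lambda) = antipode D h ⊗ 1 * (q * comul D Lambda).
Proof.
have Phi_conj : Phi^-1 * id_comul D (comul D h) = comul_id D (comul D h) * Phi^-1.
  by case: HD => -[_ _ <- _ _] _ _ _ _; rewrite !mulrA mulVr ?mul1r.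
rewrite -[h in 1 ⊗ h]counitl -[h in antipode D h]counitr.
by rewrite mulrA -qmap_comul_id -qmap_id_comul Phi_conj.
Qed.

Lemma p_left_integral h :
  comul D Lambda * p * (S' h ⊗ 1) = comul D Lambda * p * (1 ⊗ h).
Proof.
have Phi_conj : id_comul D (comul D h) * Phi = Phi * comul_id D (comul D h).
  by case: HD => -[_ _ <- _ _] _ _ _ _; rewrite mulrVK.
rewrite -[h in 1 ⊗ h]counitl -[h in S' h]counitr.
by rewrite -[RHS]mulrA -pmap_comul_id -pmap_id_comul Phi_conj.
Qed.

(** In the form [eq_pentagon], the pentagon is mapped by [R] and multiplied by Δ(Λ). Its right side
    collapses to R(Φ ⊗ 1) = 1; on its left side Δ(Λ) absorbs the Δ on the last leg of Φ, which
    leaves β in front of q_L. *)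
Lemma beta_q_left : be ⊗ 1 * (q * comul D Lambda) = comul D Lambda.
Proof.
have mor3 := snd one_tensor3_mor; have mor4 := snd comul_id_id_mor.
have eq_pentagon : one_tensor3 Phi^-1 * id_id_comul D Phi
    = id_comul_id D Phi * ((Phi ⊗ 1) * comul_id_id D Phi^-1).
  (* The factor 1 is inserted as the image of Φ Φ^-1 under Δ ⊗ id ⊗ id, to expose the left side of
     the pentagon. *)
  rewrite -[id_id_comul D Phi]mulr1 -(fst comul_id_id_mor) -(divrr Phi_unit) mor4.
  rewrite (mulrA (id_id_comul D Phi)) pentagon !mulrA -mor3 mulVr //.
  by rewrite (fst one_tensor3_mor) mul1r.
(* Seen as acted on by (id ⊗ id ⊗ ε)(Φ) = 1, β has the shape that [R_integral] produces. *)
have idc : be ⊗ 1 = act_beta be (id_id_counit Phi) ⊗ 1 :> tensor H H.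
  by rewrite id_id_counit_associator pure11 act_beta_pure S1 mulr1 mul1r.
have R_integral v u : R (one_tensor3 u * id_id_comul D v) * comul D Lambda
    = act_beta be (id_id_counit v) ⊗ 1 * (qmap al u * comul D Lambda).
  move: v; apply: tensor_eq_lin => [||t c]; [lin|lin|].
  rewrite id_id_comul_pure R_one_tensor3 id_id_counit_pure -!mulrA.
  rewrite comul_Lambdal (linear_Z _ _ (act_beta_linear be)).
  by rewrite pureZl -!scalerAl -!scalerAr.
rewrite idc -[q]/(qmap al Phi^-1) -R_integral eq_pentagon R_id_comul_id.
rewrite R_comul_id_id (invV counit_id_id_mor counit_id_id_associator) mulr1.
rewrite /counit_mid Phi_counit R_pure.
have -> : T Phi = 1 by case: HD => _ _ _ _ [].
by rewrite -pure11 !mul1r.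
Qed.

(** The mirror argument: the pentagon is solved for (id ⊗ id ⊗ Δ)(Φ^-1) (1 ⊗ Φ), mapped by [R'] and
    multiplied by Δ(Λ) on the left; the other side collapses by the antipode axiom for Φ^-1. *)
Lemma p_left_alpha : comul D Lambda * p * (S' al ⊗ 1) = comul D Lambda.
Proof.
have mor2 := snd id_id_comul_mor; have mor3 := snd id_comul_id_mor.
have PhiV : (Phi ⊗ 1) * (Phi^-1 ⊗ 1) = 1 :> tensor (tensor (tensor H H) H) H.
  by rewrite pureM divrr // mulr1.
have eq_pentagon : id_id_comul D Phi^-1 * one_tensor3 Phi
    = comul_id_id D Phi * (Phi^-1 ⊗ 1) * id_comul_id D Phi^-1.
  rewrite -[comul_id_id D Phi]mul1r -(fst id_id_comul_mor) -(mulVr Phi_unit).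
  rewrite mor2 -(mulrA (id_id_comul D Phi^-1)) pentagon -!mulrA.
  rewrite (mulrA (Phi ⊗ 1)) PhiV mul1r -mor3 divrr //.
  by rewrite (fst id_comul_id_mor) mulr1.
have idc : S' al ⊗ 1 = S' (act_alpha al (id_id_counit Phi^-1)) ⊗ 1 :> tensor H H.
  rewrite (invV id_id_counit_mor id_id_counit_associator).
  by rewrite pure11 act_alpha_pure S1 mulr1 mul1r.
have R'_integral v u : comul D Lambda * R' (id_id_comul D v * one_tensor3 u)
    = comul D Lambda * pmap be u * (S' (act_alpha al (id_id_counit v)) ⊗ 1).
  move: v; apply: tensor_eq_lin => [||t c]; [lin|lin|].
  rewrite id_id_comul_pure R'_one_tensor3 id_id_counit_pure !mulrA.
  rewrite comul_Lambdar (linear_Z _ _ (act_alpha_linear al)).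
  by rewrite linearZ pureZl -!scalerAl -!scalerAr.
have mid_mor : monoid_morphism counit_mid.
  by apply: tmap_monoid_morphism; [lin|exact: id_counit_mor|lin|].
rewrite idc -[p]/(pmap be Phi) -R'_integral eq_pentagon R'_id_comul_id.
rewrite R'_comul_id_id counit_id_id_associator mul1r.
rewrite (invV mid_mor) // mulr1 R'_pure.
have -> : T' Phi^-1 = 1 by case: HD => _ _ _ _ [].
by rewrite S'1 -pure11 mulr1.
Qed.

(** * Multiplying the legs: centrality of ν and the sum of Λ1 Λ2 *)

Let mult_linear : linear (@mult k H). Proof. exact: tlift_is_linear. Qed.
#[local] Hint Resolve mult_linear : lin.

Let mult_pure (a b : H) : mult (a ⊗ b) = a * b.
Proof. by rewrite /mult tlift_pure => [|?|?] //; lin. Qed.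

Let mult_mull (a : H) t : mult (a ⊗ 1 * t) = a * mult t.
Proof.
move: t; apply: tensor_eq_lin => [||x y]; [lin|lin|].
by rewrite pureM !mult_pure mul1r mulrA.
Qed.

Let mult_mulr (a : H) t : mult (t * (1 ⊗ a)) = mult t * a.
Proof.
move: t; apply: tensor_eq_lin => [||x y]; [lin|lin|].
by rewrite pureM !mult_pure mulr1 mulrA.
Qed.

Let mult_mid (a : H) t : mult (1 ⊗ a * t) = mult (t * (a ⊗ 1)).
Proof.
move: t; apply: tensor_eq_lin => [||x y]; [lin|lin|].
by rewrite !pureM !mult_pure mul1r mulr1 mulrA.
Qed.

Lemma nu_central h : h * nu D Lambda = nu D Lambda * h.
Proof.
have nul a : antipode D a ⊗ 1 * (q * comul D Lambda * p)
    = 1 ⊗ a * (q * comul D Lambda * p).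
  by rewrite !(mulrA _ _ p) q_left_integral.
have nur a : q * comul D Lambda * p * (S' a ⊗ 1)
    = q * comul D Lambda * p * (1 ⊗ a).
  by rewrite -!(mulrA q) p_left_integral.
(* With E = q Δ(Λ) p, the common value of both sides is Σ E1 S^-1(h) E2. *)
rewrite /nu -/q -/p -mult_mulr -nur -mult_mid -nul mult_mull.
by rewrite S'K.
Qed.

Lemma mult_comul_integral : mult (comul D Lambda) = be * nu D Lambda * al.
Proof.
(* The identity behind this is Δ(Λ) = (β ⊗ 1) q Δ(Λ) p (1 ⊗ α): by [p_left_integral], the S^-1(α) of
   [p_left_alpha] on the first leg may be replaced by α on the second. *)
rewrite -mulrA -mult_mulr -mult_mull -{1}p_left_alpha -{1}beta_q_left.
by rewrite -!mulrA !(mulrA _ p) p_left_integral /nu -!mulrA.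
Qed.

(** * Invariance under gauge transformations *)

Section Gauge.
Variable F : tensor H H.
Hypothesis HF : is_gauge D F.

Let F_unit : F \is a GRing.unit. Proof. by case: HF. Qed.

Let counit_id_FV : counit_id D F^-1 = 1.
Proof.
case: (monoid_morphismV counit_id_mor F_unit) => _ <-.
by case: HF => _ -> _; rewrite invr1.
Qed.

Let id_counit_FV : id_counit D F^-1 = 1.
Proof.
case: (monoid_morphismV id_counit_mor F_unit) => _ <-.
by case: HF => _ _ ->; rewrite invr1.
Qed.

Lemma gauge_associatorV : (associator (gauge_twist D F))^-1
  = F ⊗ 1 * (comul_id D F * (Phi^-1 * id_comul D F^-1 * one_tensor2 F^-1)).
Proof.
have mor1 := @pure1r_monoid_morphism k (tensor H H) H.
have FV_unit : F^-1 \is a GRing.unit by rewrite unitrV.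
have [U1 V1] := monoid_morphismV one_tensor2_mor F_unit.
have [U2 V2] := monoid_morphismV id_comul_mor F_unit.
have [U3 V3] := monoid_morphismV comul_id_mor FV_unit.
have [U4 V4] := monoid_morphismV mor1 FV_unit.
rewrite /= !invrM ?(unitrMl, U2) //.
by rewrite V1 V2 V3 V4 !invrK !mulrA.
Qed.

(** Each factor of Φ_F^-1 that comes from F disappears: F ⊗ 1 turns α_F back into α, (Δ ⊗ id)(F)
    becomes a counit at α, 1 ⊗ F^-1 cancels the explicit F, and (id ⊗ Δ)(F^-1) is absorbed by
    Δ(Λ). *)
Lemma q_left_gauge :
  q_left (gauge_twist D F) * F * comul D Lambda = q * comul D Lambda.
Proof.
rewrite -[q_left _]/(qmap (act_alpha al F^-1) _^-1) gauge_associatorV.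
rewrite qmap_pure1 -act_alpha_mul mulVr // pure11 act_alpha_pure S1 mulr1 mul1r.
rewrite qmap_comul_id qmap_one_tensor2.
have -> : counit_id D F = 1 by case: HF.
by rewrite -pure11 mul1r mulrVK // qmap_id_comul id_counit_FV S1 -pure11 mul1r.
Qed.

Lemma p_left_gauge :
  comul D Lambda * F^-1 * p_left (gauge_twist D F) = comul D Lambda * p.
Proof.
rewrite -[p_left _]/(pmap (act_beta be F) (associator (gauge_twist D F))) /=.
rewrite pmap_pure1 -act_beta_mul mulVr // pure11 act_beta_pure S1 mulr1 mul1r.
rewrite pmap_comul_id counit_id_FV -pure11 mulr1 -!(mulrA (one_tensor2 F)).
rewrite pmap_one_tensor2 !mulrA mulrVK // pmap_id_comul.
have -> : id_counit D F = 1 by case: HF.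
by rewrite S'1 -pure11 mulr1.
Qed.

Lemma nu_gauge : nu (gauge_twist D F) Lambda = nu D Lambda.
Proof.
rewrite /nu /= !mulrA q_left_gauge -!mulrA (mulrA (comul D Lambda)).
by rewrite p_left_gauge.
Qed.

End Gauge.

End QuasiHopf.

(** The product l' l equals l because l is an integral, and l' because l' is one. *)
Lemma normalized_integral_unique (k : fieldType) (H : falgType k)
    (D : quasi_hopf_data H) (l l' : H) :
  normalized_integral D l -> normalized_integral D l' -> l = l'.
Proof.
move=> [il el] [il' el']; have := (il' l).2.
by rewrite (il l').1 el el' !scale1r.
Qed.

Theorem corollary3p5 (k : fieldType) (H : falgType k) (D : quasi_hopf_data H)
    (Lambda : H) :
  is_quasi_hopf D -> semisimple H -> normalized_integral D Lambda ->
  [/\ forall (F : tensor H H) (Lambda_F : H),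
        is_gauge D F -> normalized_integral (gauge_twist D F) Lambda_F ->
        nu D Lambda = nu (gauge_twist D F) Lambda_F,
      qbeta D * qalpha D * nu D Lambda = nu D Lambda * (qbeta D * qalpha D),
      nu D Lambda * (qbeta D * qalpha D) = mult (comul D Lambda)
    & qalpha D \is a GRing.unit -> qbeta D \is a GRing.unit ->
      nu D Lambda = mult (comul D Lambda) * (qbeta D * qalpha D)^-1 /\
      nu D Lambda = (qbeta D * qalpha D)^-1 * mult (comul D Lambda)].
Proof.
move=> HD _ HL; have nuC := nu_central HD HL.1.
have multE : nu D Lambda * (qbeta D * qalpha D) = mult (comul D Lambda).
  by rewrite (mult_comul_integral HD HL.1) nuC mulrA.
split=> // [F l HF Hl | Ua Ub].
  (* The twist keeps the product and ε, so a normalized integral of H_F is, by conversion, one of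
     [D]. *)
  have -> : l = Lambda by apply: (@normalized_integral_unique _ _ D).
  by rewrite (nu_gauge HD HL.1 HF).
have Uba : qbeta D * qalpha D \is a GRing.unit by rewrite unitrMl.
by rewrite -multE mulrK // -nuC mulKr.
Qed.
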